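(* Let $(KNP): K\xrightarrow{i_0}N\xrightarrow{\pi_0}P$ and $(PQR): P\xrightarrow{\bar\jmath}Q\xrightarrow{\bar\phi}R$ be group extensions. Let $(G,j,\pi)$ and $(G',j',\pi')$ be iterated extensions of $(KNP)$ by $(PQR)$ with the same mod-$K$ outer action $\Theta:Q\to\mathrm{Out}(N;K)$. Then their $Q$-main extensions $(G,i,\pi)$ and $(G',i',\pi')$ of $K$ by $Q$ are isomorphic if and only if there exists an automorphism $\eta\in\mathrm{Aut}(KNP)$ of the extension $(KNP)$ such that the iterated extensions $(G,j^\eta,\pi)$, where $j^\eta:=j\circ\eta$, and $(G',j',\pi')$ are isomorphic.
   Context: A group extension $K\xrightarrow{i}G\xrightarrow{\pi}Q$ (also written $(G,i,\pi)$, an extension of $K$ by $Q$) consists of an injective homomorphism $i$ and a surjective homomorphism $\pi$ with $i(K)=\mathrm{Ker}(\pi)$; groups are identified with their images under the given injections. Two extensions $(G_\ell,i_\ell,\pi_\ell)$ of $K$ by $Q$ are isomorphic iff there is a group isomorphism $\varphi:G_1\to G_2$ with $\varphi\circ i_1=i_2$ and $\pi_2\circ\varphi=\pi_1$. An iterated extension of $(KNP)$ by $(PQR)$ is a triple $(G,j,\pi)$ with $G$ a group, $j:N\to G$ an injective homomorphism and $\pi:G\to Q$ a surjective homomorphism such that, with $i:=j\circ i_0$ and $\phi:=\bar\phi\circ\pi$, one has $\pi\circ j=\bar\jmath\circ\pi_0$, $j(N)=\mathrm{Ker}(\phi)$ and $i(K)=\mathrm{Ker}(\pi)$. Its $Q$-main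 extension is the extension $(G,i,\pi)$ of $K$ by $Q$. Two iterated extensions $(G_\ell,j_\ell,\pi_\ell)$ are isomorphic iff there is a group isomorphism $\varphi:G_1\to G_2$ with $\varphi\circ j_1=j_2$ and $\pi_2\circ\varphi=\pi_1$. $\mathrm{Aut}_K(N)$ is the group of automorphisms of $N$ mapping $K$ onto $K$, and $\mathrm{Out}(N;K):=\mathrm{Aut}_K(N)/\complement_N(K)$, where $\complement_N(K)$ is the group of inner automorphisms of $N$ by elements of $K$. The mod-$K$ outer action of $(G,j,\pi)$ is the homomorphism $Q\to\mathrm{Out}(N;K)$ sending $\pi(g)$ to the class of conjugation by $g\in G$ on $N$ (via $j$). $\mathrm{Aut}(KNP):=\{\eta\in\mathrm{Aut}(N):\eta\circ i_0=i_0,\ \pi_0\circ\eta=\pi_0\}$. For $\eta\in\mathrm{Aut}(KNP)$, $(G,j\circ\eta,\pi)$ is again an iterated extension of $(KNP)$ by $(PQR)$. *)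

(* Defs.v *)
From HB Require Import structures.
From mathcomp Require Import all_boot.
From mathcomp Require Import boolp classical_sets.

Set Implicit Arguments.
Unset Strict Implicit.
Unset Printing Implicit Defensive.

Local Open Scope group_scope.
Local Open Scope classical_set_scope.

(* Groups are arbitrary (possibly infinite) groups, i.e. [groupType]. The
   choice structure contained in [groupType] is no restriction, since the axioms
   of [boolp] provide one on every type. *)

Notation "{ 'gmorphism' G -> H }" :=
  (UMagmaMorphism.type G%type H%type)
  (at level 0, G at level 98, H at level 99) : type_scope.

Lemma morphM_monoid (G H : groupType) (f : G -> H) :
  {morph f : x y / x * y} -> monoid_morphism f.
Proof. by move=> fM; split=> //; apply: (@mulgI _ (f 1)); rewrite -fM !mulg1. Qed.

Record normal_subgroup (G : groupType) := NormalSubgroup {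
  ns_set :> G -> Prop;
  ns1 : ns_set 1;
  nsM : forall x y, ns_set x -> ns_set y -> ns_set (x * y);
  nsV : forall x, ns_set x -> ns_set x^-1;
  nsJ : forall x y, ns_set x -> ns_set (x ^ y)
}.

Section Quotient.
Variables (G : groupType) (H : normal_subgroup G).

Definition coset_rel : rel G := fun x y => `[< H (x^-1 * y) >].

Lemma coset_rel_refl : reflexive coset_rel.
Proof. by move=> x; apply/asboolP; rewrite mulVg; exact: ns1. Qed.

Lemma coset_rel_sym : symmetric coset_rel.
Proof.
have aux x y : H (x^-1 * y) -> H (y^-1 * x).
  by move=> /(@nsV _ H); rewrite invgM invgK.
by move=> x y; apply/asboolP/asboolP; exact: aux.
Qed.

Lemma coset_rel_trans : transitive coset_rel.
Proof.
move=> y x z /asboolP xy /asboolP yz; apply/asboolP.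
by have := nsM xy yz; rewrite mulgA mulgK.
Qed.

Canonical coset_equiv :=
  EquivRel coset_rel coset_rel_refl coset_rel_sym coset_rel_trans.

Definition quot_group := {eq_quot coset_equiv}%qT.
HB.instance Definition _ := Choice.on quot_group.
HB.instance Definition _ := EqQuotient.on quot_group.

Definition coset_class (x : G) : quot_group := (\pi_quot_group x)%qT.

Lemma coset_classP x y : coset_class x = coset_class y <-> H (x^-1 * y).
Proof.
by split=> [/eqP|Hxy]; [rewrite eqmodE => /asboolP|apply/eqP; rewrite eqmodE; apply/asboolP].
Qed.

Lemma coset_class_surj (q : quot_group) : exists x, coset_class x = q.
Proof. by exists (repr q)%qT; rewrite /coset_class reprK. Qed.

Definition quot_one : quot_group := coset_class 1.
Definition quot_mul (a b : quot_group) : quot_group :=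
  coset_class (repr a * repr b)%qT.
Definition quot_inv (a : quot_group) : quot_group :=
  coset_class (repr a)%qT^-1.

Lemma repr_coset x : H (x^-1 * repr (coset_class x))%qT.
Proof. by apply/coset_classP; rewrite /coset_class reprK. Qed.

Lemma quot_mulE x y :
  quot_mul (coset_class x) (coset_class y) = coset_class (x * y).
Proof.
apply/esym/coset_classP.
set x' := repr (coset_class x); set y' := repr (coset_class y).
have -> : (x * y)^-1 * (x' * y') = (x^-1 * x') ^ y * (y^-1 * y').
  by rewrite conjgE invgM !mulgA mulgK.
by apply: nsM; [apply: nsJ|]; exact: repr_coset.
Qed.

Lemma quot_invE x : quot_inv (coset_class x) = coset_class x^-1.
Proof.
apply/coset_classP; rewrite invgK; set x' := repr _.
have -> : x' * x^-1 = (x^-1 * x') ^ x^-1 by rewrite conjgE invgK !mulgA mulgV mul1g.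
by apply: nsJ; exact: repr_coset.
Qed.

Lemma quot_mulA : associative quot_mul.
Proof.
move=> a b c; case: (coset_class_surj a) (coset_class_surj b) (coset_class_surj c).
by move=> x <- [y <-] [z <-]; rewrite !quot_mulE mulgA.
Qed.

Lemma quot_mul1 : left_id quot_one quot_mul.
Proof. by move=> a; case: (coset_class_surj a) => x <-; rewrite quot_mulE mul1g. Qed.

Lemma quot_mulr1 : right_id quot_one quot_mul.
Proof. by move=> a; case: (coset_class_surj a) => x <-; rewrite quot_mulE mulg1. Qed.

Lemma quot_mulV : left_inverse quot_one quot_inv quot_mul.
Proof.
by move=> a; case: (coset_class_surj a) => x <-; rewrite quot_invE quot_mulE mulVg.
Qed.

Lemma quot_mulrV : right_inverse quot_one quot_inv quot_mul.
Proof.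
by move=> a; case: (coset_class_surj a) => x <-; rewrite quot_invE quot_mulE mulgV.
Qed.

HB.instance Definition _ := isGroup.Build quot_group
  quot_mulA quot_mul1 quot_mulr1 quot_mulV quot_mulrV.

Lemma coset_classM : {morph coset_class : x y / x * y}.
Proof. by move=> x y; rewrite -quot_mulE. Qed.

HB.instance Definition _ :=
  isUMagmaMorphism.Build G quot_group coset_class (morphM_monoid coset_classM).

End Quotient.

Record gaut (N : groupType) := Gaut {
  gaut_fun :> N -> N;
  gaut_morph : {morph gaut_fun : x y / x * y};
  gaut_bij : bijective gaut_fun
}.

Section AutomorphismGroup.
Variable N : groupType.

HB.instance Definition _ := gen_eqMixin (gaut N).
HB.instance Definition _ := gen_choiceMixin (gaut N).

HB.instance Definition _ (f : gaut N) :=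
  isUMagmaMorphism.Build N N (gaut_fun f) (morphM_monoid (@gaut_morph N f)).

Lemma gautP (f g : gaut N) : f =1 g -> f = g.
Proof.
case: f g => [f fM fB] [g gM gB] /= /funext fg; subst g.
by congr Gaut; exact: Prop_irrelevance.
Qed.

Definition gaut_one : gaut N :=
  @Gaut N idfun (fun _ _ => erefl) (Bijective (fun=> erefl) (fun=> erefl)).

Lemma gaut_mul_morph (f g : gaut N) : {morph f \o g : x y / x * y}.
Proof. by move=> x y /=; rewrite !gaut_morph. Qed.

Definition gaut_mul (f g : gaut N) : gaut N :=
  Gaut (gaut_mul_morph f g) (bij_comp (gaut_bij f) (gaut_bij g)).

Lemma gaut_inv_exists (f : gaut N) : exists h : N -> N, cancel f h /\ cancel h f.
Proof. by case: (gaut_bij f) => h fK hK; exists h. Qed.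

Definition gaut_inv_fun (f : gaut N) : N -> N := sval (cid (gaut_inv_exists f)).

Lemma gaut_funK (f : gaut N) : cancel f (gaut_inv_fun f).
Proof. by rewrite /gaut_inv_fun; case: cid => h []. Qed.

Lemma gaut_inv_funK (f : gaut N) : cancel (gaut_inv_fun f) f.
Proof. by rewrite /gaut_inv_fun; case: cid => h []. Qed.

Definition gaut_inv (f : gaut N) : gaut N :=
  Gaut (can2_gmulfM (f := f) (gaut_funK f) (gaut_inv_funK f))
       (Bijective (gaut_inv_funK f) (gaut_funK f)).

Lemma gaut_mulA : associative gaut_mul.
Proof. by move=> f g h; apply: gautP. Qed.
Lemma gaut_mul1 : left_id gaut_one gaut_mul.
Proof. by move=> f; apply: gautP. Qed.
Lemma gaut_mulr1 : right_id gaut_one gaut_mul.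
Proof. by move=> f; apply: gautP. Qed.
Lemma gaut_mulV : left_inverse gaut_one gaut_inv gaut_mul.
Proof. by move=> f; apply: gautP => x /=; rewrite gaut_funK. Qed.
Lemma gaut_mulrV : right_inverse gaut_one gaut_inv gaut_mul.
Proof. by move=> f; apply: gautP => x /=; rewrite gaut_inv_funK. Qed.

HB.instance Definition _ := isGroup.Build (gaut N)
  gaut_mulA gaut_mul1 gaut_mulr1 gaut_mulV gaut_mulrV.

(* Conjugation [x |-> n x n^-1]: with this convention [inner_aut] is a
   homomorphism for the product [f * g = f \o g]. *)
Lemma inner_morph (n : N) : {morph (fun x => n * x / n) : x y / x * y}.
Proof. by move=> x y /=; rewrite !mulgA mulgVK. Qed.

Lemma inner_bij (n : N) : bijective (fun x => n * x / n).
Proof.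
by exists (fun x => x ^ n) => x; rewrite conjgE; rewrite !mulgA ?mulgVK ?mulVg ?mulgV ?mul1g ?mulgK.
Qed.

Definition inner_aut (n : N) : gaut N := Gaut (@inner_morph n) (inner_bij n).

End AutomorphismGroup.

Record extension (K Q : groupType) := Extension {
  ext_group :> groupType;
  ext_inj : {gmorphism K -> ext_group};
  ext_proj : {gmorphism ext_group -> Q};
  ext_inj_injective : injective ext_inj;
  ext_proj_surjective : forall q, exists g, ext_proj g = q;
  ext_exact : range ext_inj = [set g | ext_proj g = 1]
}.

Definition extension_iso (K Q : groupType) (E1 E2 : extension K Q) : Prop :=
  exists2 f : {gmorphism E1 -> E2}, bijective f &
    f \o ext_inj E1 =1 ext_inj E2 /\ ext_proj E2 \o f =1 ext_proj E1.

Section ExtensionAutomorphisms.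
Variables (K P : groupType) (N : extension K P).

Definition stab_ker : pred (gaut N) :=
  fun f => `[< f @` range (ext_inj N) = range (ext_inj N) >].

Lemma stab_ker_group_closed : group_closed stab_ker.
Proof.
split; first by apply/asboolP; rewrite image_id.
move=> f g /asboolP fK /asboolP gK; apply/asboolP.
have gVK : gaut_inv g @` range (ext_inj N) = range (ext_inj N).
  apply/seteqP; split=> [_ [x Kx <-]|x Kx].
    by move: Kx; rewrite -[in X in X -> _]gK => -[y Ky <-] /=; rewrite gaut_funK.
  by exists (g x); [rewrite -gK; exists x|exact: gaut_funK].
transitivity (f @` (gaut_inv g @` range (ext_inj N))); last by rewrite gVK.
by apply/esym; exact: image_comp.
Qed.

Definition AutK := {f : gaut N | stab_ker f}.
HB.instance Definition _ := Choice.on AutK.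
HB.instance Definition _ := SubChoice.on AutK.
HB.instance Definition _ :=
  SubChoice_isSubGroup.Build (gaut N) stab_ker AutK stab_ker_group_closed.

Lemma inner_stab_ker (k : K) : stab_ker (inner_aut (ext_inj N k)).
Proof.
apply/asboolP/seteqP; split=> [_ [_ [l _ <-] <-]|_ [l _ <-]] /=.
  by exists (k * l / k) => //; rewrite gmulfF gmulfM.
exists (ext_inj N (l ^ k)); first by exists (l ^ k).
by rewrite gmulfJ conjgE !mulgA mulgV mul1g mulgK.
Qed.

Definition inner_AutK (k : K) : AutK := Sub (inner_aut (ext_inj N k)) (inner_stab_ker k).

Lemma inner_AutKM : {morph inner_AutK : k l / k * l}.
Proof.
move=> k l; apply/val_inj; rewrite valM; apply: gautP => x /=.
by rewrite gmulfM invgM !mulgA.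
Qed.
HB.instance Definition _ :=
  isUMagmaMorphism.Build K AutK inner_AutK (morphM_monoid inner_AutKM).

Lemma inner_AutKJ k (f : AutK) : range inner_AutK (inner_AutK k ^ f).
Proof.
have /asboolP fVK : stab_ker (val f^-1) := valP f^-1.
have : range (ext_inj N) (val f^-1 (ext_inj N k)).
  by rewrite -fVK; exists (ext_inj N k) => //; exists k.
case=> l _ lE; exists l => //; rewrite conjgE; apply/val_inj; rewrite !valM.
have fVf x : val f^-1 (val f x) = x by exact: gaut_funK.
apply: gautP => x; transitivity (val f^-1 (ext_inj N k * val f x / ext_inj N k)).
  rewrite gmulfF gmulfM [LHS]/(ext_inj N l * x / ext_inj N l) lE; congr (_ * _ / _); exact/esym/fVf.
by [].
Qed.

Lemma InnK1 : range inner_AutK 1.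
Proof. by exists 1 => //; rewrite gmulf1. Qed.

Lemma InnKM f g :
  range inner_AutK f -> range inner_AutK g -> range inner_AutK (f * g).
Proof. by move=> [k _ <-] [l _ <-]; exists (k * l) => //; rewrite gmulfM. Qed.

Lemma InnKV f : range inner_AutK f -> range inner_AutK f^-1.
Proof. by move=> [k _ <-]; exists k^-1 => //; rewrite gmulfV. Qed.

Lemma InnKJ f g : range inner_AutK f -> range inner_AutK (f ^ g).
Proof. by move=> [k _ <-]; exact: inner_AutKJ. Qed.

(* The group [C_N(K)] of inner automorphisms of [N] by elements of [K]. *)
Definition InnK : normal_subgroup AutK :=
  NormalSubgroup InnK1 InnKM InnKV InnKJ.

Definition OutK : groupType := quot_group InnK.

Record AutExt := mkAutExt {
  autext_val :> gaut N;
  autext_inj : autext_val \o ext_inj N =1 ext_inj N;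
  autext_proj : ext_proj N \o autext_val =1 ext_proj N
}.

End ExtensionAutomorphisms.

Section IteratedExtension.
Variables (K P R : groupType) (N : extension K P) (Q : extension P R).

Record iterated_extension := IteratedExtension {
  it_group :> groupType;
  it_inj : {gmorphism N -> it_group};
  it_proj : {gmorphism it_group -> Q};
  it_inj_injective : injective it_inj;
  it_proj_surjective : forall q, exists g, it_proj g = q;
  it_comm : it_proj \o it_inj =1 ext_inj Q \o ext_proj N;
  it_exactN : range it_inj = [set g | (ext_proj Q \o it_proj) g = 1];
  it_exactK : range (it_inj \o ext_inj N) = [set g | it_proj g = 1]
}.

Definition iterated_iso (X1 X2 : iterated_extension) : Prop :=
  exists2 f : {gmorphism X1 -> X2}, bijective f &
    f \o it_inj X1 =1 it_inj X2 /\ it_proj X2 \o f =1 it_proj X1.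

Lemma main_inj_injective (X : iterated_extension) :
  injective (it_inj X \o ext_inj N).
Proof. exact: inj_comp (@it_inj_injective X) (@ext_inj_injective _ _ N). Qed.

Definition main_extension (X : iterated_extension) : extension K Q :=
  @Extension K Q (it_group X) (it_inj X \o ext_inj N) (it_proj X)
    (@main_inj_injective X) (@it_proj_surjective X) (it_exactK X).

Section Twist.
Variables (X : iterated_extension) (eta : AutExt N).

Lemma twist_inj_injective : injective (it_inj X \o eta).
Proof. exact: inj_comp (@it_inj_injective X) (bij_inj (gaut_bij eta)). Qed.

Lemma twist_comm : it_proj X \o (it_inj X \o eta) =1 ext_inj Q \o ext_proj N.
Proof.
by move=> n /=; have := it_comm X (eta n); rewrite /= => ->; rewrite -[in RHS](autext_proj eta).
Qed.

Lemma twist_exactN :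
  range (it_inj X \o eta) = [set g | (ext_proj Q \o it_proj X) g = 1].
Proof.
rewrite -it_exactN; apply/seteqP; split=> [_ [n _ <-]|_ [n _ <-]].
  by exists (eta n).
by exists (gaut_inv_fun eta n) => //=; rewrite gaut_inv_funK.
Qed.

Lemma twist_exactK :
  range ((it_inj X \o eta) \o ext_inj N) = [set g | it_proj X g = 1].
Proof.
rewrite -it_exactK; apply: eq_imagel => k _ /=.
by have /= -> := autext_inj eta k.
Qed.

Definition twist : iterated_extension :=
  @IteratedExtension (it_group X) (it_inj X \o eta) (it_proj X)
    twist_inj_injective (@it_proj_surjective X)
    twist_comm twist_exactN twist_exactK.

End Twist.

Section OuterAction.
Variable X : iterated_extension.
Local Notation i := (ext_inj N).
Local Notation j := (it_inj X).
Local Notation p := (it_proj X).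

Lemma it_conj_exists (g : X) (n : N) : exists m, j m = g * j n / g.
Proof.
have : [set h | (ext_proj Q \o p) h = 1] (g * j n / g).
  have : [set h | (ext_proj Q \o p) h = 1] (j n) by rewrite -it_exactN; exists n.
  by rewrite /= !gmulfM !gmulfV => ->; rewrite mulg1 mulgV.
by rewrite -it_exactN => -[m _ mE]; exists m.
Qed.

Definition it_conj_fun (g : X) (n : N) : N := sval (cid (it_conj_exists g n)).

Lemma it_conj_funE g n : j (it_conj_fun g n) = g * j n / g.
Proof. exact: (svalP (cid (it_conj_exists g n))). Qed.

Lemma it_conj_morph g : {morph it_conj_fun g : x y / x * y}.
Proof.
move=> x y; apply: (@it_inj_injective X).
by rewrite gmulfM !it_conj_funE gmulfM !mulgA mulgVK.
Qed.

Lemma it_conj_funK g : cancel (it_conj_fun g) (it_conj_fun g^-1).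
Proof.
move=> x; apply: (@it_inj_injective X).
by rewrite !it_conj_funE invgK !mulgA mulgVK mulVg mul1g.
Qed.

Lemma it_conj_bij g : bijective (it_conj_fun g).
Proof.
exists (it_conj_fun g^-1); first exact: it_conj_funK.
by move=> x; rewrite -[g in it_conj_fun g]invgK it_conj_funK.
Qed.

Definition it_conj (g : X) : gaut N := Gaut (@it_conj_morph g) (it_conj_bij g).

Lemma it_conjE (g : X) (n : N) : j (it_conj g n) = g * j n / g.
Proof. exact: it_conj_funE. Qed.

Lemma it_conj_stab g : stab_ker (it_conj g).
Proof.
have sub h k : range i (it_conj h (i k)).
  have : [set g | p g = 1] (j (it_conj h (i k))).
    have : [set h | p h = 1] (j (i k)) by rewrite -it_exactK; exists k.
    by rewrite /= it_conjE !gmulfM !gmulfV => ->; rewrite mulg1 mulgV.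
  by rewrite -it_exactK => -[l _ /(@it_inj_injective X) lE]; exists l.
apply/asboolP/seteqP; split=> [_ [_ [k _ <-] <-]|_ [k _ <-]]; first exact: sub.
by exists (it_conj g^-1 (i k)); [exact: sub|rewrite -[g in it_conj g]invgK; exact: it_conj_funK].
Qed.

Definition it_conjK (g : X) : AutK N := Sub (it_conj g) (it_conj_stab g).

Lemma it_conjKM : {morph it_conjK : g h / g * h}.
Proof.
move=> g h; apply/val_inj; rewrite valM; apply: gautP => n; apply: (@it_inj_injective X).
by rewrite it_conjE /= !it_conj_funE invgM !mulgA.
Qed.
HB.instance Definition _ :=
  isUMagmaMorphism.Build X (AutK N) it_conjK (morphM_monoid it_conjKM).

Definition outer_action (q : Q) : OutK N :=
  coset_class (InnK N) (it_conjK (sval (cid (@it_proj_surjective X q)))).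

Lemma outer_actionE (g : X) :
  outer_action (p g) = coset_class (InnK N) (it_conjK g).
Proof.
rewrite /outer_action; case: cid => h /= hE; apply/coset_classP.
have : [set x | p x = 1] (h^-1 * g) by rewrite /= gmulfM gmulfV hE mulVg.
rewrite -it_exactK => -[k _ kE]; exists k => //.
rewrite -gmulfV -gmulfM -kE; apply/val_inj; apply: gautP => n.
by apply: (@it_inj_injective X); rewrite it_conjE /= !gmulfM gmulfV.
Qed.

Lemma outer_actionM : {morph outer_action : q r / q * r}.
Proof.
move=> q r; have [g <-] := @it_proj_surjective X q.
have [h <-] := @it_proj_surjective X r.
by rewrite -gmulfM !outer_actionE !gmulfM.
Qed.
HB.instance Definition _ :=
  isUMagmaMorphism.Build Q (OutK N) outer_action (morphM_monoid outer_actionM).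

End OuterAction.

End IteratedExtension.

(* Main.v *)
Require Import Defs.
From HB Require Import structures.
From mathcomp Require Import all_boot.
From mathcomp Require Import boolp classical_sets.

(** In an iterated extension, the copy of [N] inside the group [G] is the
    preimage under [G -> Q] of the normal subgroup [P] of [Q]; it is therefore
    determined by the projection [G -> Q] alone.  Hence an isomorphism [f] of
    [Q]-main extensions carries [j(N)] onto [j'(N)] (lemma
    [main_iso_range]), so that [f \o j] and [j'] are two embeddings of [N] in
    [G'] with the same image.  Such embeddings differ by a unique automorphism
    [eta] of [N] (lemma [same_range_gaut]), which is characterised by
    [f \o (j \o eta) = j'].  Restricted to [K], this equation makes [eta] the
    identity because [f] fixes [K]; composed with the projection to [Q], it
    makes [eta] induce the identity on [P] because [f] lies over [Q] and [P]
    embeds in [Q].  So [eta] is in [Aut(KNP)] and [f] is an isomorphism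
    from the [eta]-twist of [G] to [G'].

    Conversely, elements of [Aut(KNP)] fix [K] pointwise, so twisting by them
    leaves the [Q]-main extension unchanged. *)

Local Open Scope group_scope.
Local Open Scope classical_set_scope.

(** The automorphism is [u^-1 \o v], where [u^-1] is defined on the common
    image; the roles of [u] and [v] being symmetric, it is invertible. *)
Lemma same_range_gaut (N H : groupType) (u v : {gmorphism N -> H}) :
  injective u -> injective v -> range u = range v ->
  exists eta : gaut N, u \o eta =1 v.
Proof.
move=> u_inj v_inj uv.
have lift_v n : exists m, u m = v n.
  have [m _ um] : range u (v n) by rewrite uv; exists n.
  by exists m.
have lift_u n : exists m, v m = u n.
  have [m _ vm] : range v (u n) by rewrite -uv; exists n.
  by exists m.
have [e eE] := choice lift_v; have [d dE] := choice lift_u.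
have eM : {morph e : x y / x * y}.
  by move=> x y; apply: u_inj; rewrite gmulfM !eE gmulfM.
have eB : bijective e.
  by exists d => x; [apply: v_inj; rewrite dE eE | apply: u_inj; rewrite eE dE].
by exists (Gaut eM eB).
Qed.

Section IteratedExtensions.
Variables (K P R : groupType) (KNP : extension K P) (PQR : extension P R).
Implicit Types G : iterated_extension KNP PQR.

(** The image of [N] is the kernel of the composite [G -> Q -> R], and [f]
    is compatible with the projections to [Q]. *)
Lemma main_iso_range G G' (f : {gmorphism G -> G'}) :
  bijective f -> it_proj G' \o f =1 it_proj G ->
  range (f \o it_inj G) = range (it_inj G').
Proof.
move=> [h fK hK] fp; rewrite -(image_comp (it_inj G) f) !it_exactN.
apply/seteqP; split=> [_ [g g1 <-]|g' g1] /=.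
  by have /= -> := fp g.
exists (h g'); last exact: hK.
by rewrite /= -(fp (h g')) /= hK.
Qed.

(** Composing [f \o j \o eta = j'] with the inclusion of [K] and cancelling
    [f \o j] gives the first conclusion; composing it with the projection
    to [Q], which absorbs [f], gives the second. *)
Lemma aligning_gaut_AutExt G G' (f : {gmorphism G -> G'}) (eta : gaut KNP) :
  injective f ->
  f \o (it_inj G \o ext_inj KNP) =1 it_inj G' \o ext_inj KNP ->
  it_proj G' \o f =1 it_proj G ->
  f \o (it_inj G \o eta) =1 it_inj G' ->
  eta \o ext_inj KNP =1 ext_inj KNP /\ ext_proj KNP \o eta =1 ext_proj KNP.
Proof.
move=> f_inj fi fp feta; split=> x /=.
  by apply: (@it_inj_injective _ _ _ _ _ G); apply: f_inj; rewrite [LHS]feta -[LHS]fi.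
(* Since [P] embeds in [Q], equality can be tested in [Q], where both sides
   become values of the projections of [G] and [G']. *)
apply: (@ext_inj_injective _ _ PQR).
rewrite -[LHS](it_comm G (eta x)) -[RHS](it_comm G' x) /=.
by rewrite -(feta x) -[LHS]fp.
Qed.

Lemma main_iso_twist_iso G G' :
  extension_iso (main_extension G) (main_extension G') ->
  exists eta : AutExt KNP, iterated_iso (twist G eta) G'.
Proof.
move=> [f f_bij [/= fi fp]].
have f_inj := bij_inj f_bij.
have [|||eta feta] :=
  @same_range_gaut KNP G' (f \o it_inj G : {gmorphism _ -> _}) (it_inj G').
- exact: inj_comp f_inj (@it_inj_injective _ _ _ _ _ G).
- exact: it_inj_injective.
- exact: main_iso_range.
have [eta_i eta_p] := @aligning_gaut_AutExt G G' f eta f_inj fi fp feta.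
by exists (mkAutExt eta_i eta_p), f.
Qed.

Lemma twist_iso_main_iso G G' (eta : AutExt KNP) :
  iterated_iso (twist G eta) G' ->
  extension_iso (main_extension G) (main_extension G').
Proof.
move=> [f f_bij [/= fj fp]]; exists f => //; split=> // k /=.
by rewrite -(fj (ext_inj KNP k)) /=; have /= -> := autext_inj eta k.
Qed.

End IteratedExtensions.

Theorem proposition14p4 (K P R : groupType)
    (KNP : extension K P) (PQR : extension P R)
    (G G' : iterated_extension KNP PQR)
    (Theta : {gmorphism PQR -> OutK KNP}) :
  outer_action G =1 Theta -> outer_action G' =1 Theta ->
  extension_iso (main_extension G) (main_extension G') <->
  exists eta : AutExt KNP, iterated_iso (twist G eta) G'.
Proof.
move=> _ _; split; first exact: main_iso_twist_iso.
by move=> [eta]; exact: twist_iso_main_iso.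
Qed.
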